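(* Let $G$ be a connected graph of order $n\geq 3$ with minimum degree $\delta(G)\geq 2$. If $\gamma_{t[1,2]}(G)<+\infty$, then $\gamma_{t[1,2]}(G)\leq \frac{2n}{3}$.
   Context: All graphs are finite, simple and undirected; $N(v)$ denotes the neighborhood of $v$. A set $S\subseteq V(G)$ is a total $[1,2]$-set of $G$ if $1\leq |N(v)\cap S|\leq 2$ for every vertex $v\in V(G)$. $\gamma_{t[1,2]}(G)$ is the minimum cardinality of a total $[1,2]$-set of $G$, with $\gamma_{t[1,2]}(G)=+\infty$ if no such set exists. *)

(* Defs.v *)
From mathcomp Require Import all_boot all_order all_algebra.
From mathcomp Require Import constructive_ereal.
Set Implicit Arguments.
Unset Strict Implicit.
Unset Printing Implicit Defensive.
Import Order.TTheory GRing.Theory Num.Theory.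

(* A finite simple graph is a symmetric irreflexive relation e on a finType. *)
Definition simple_graph (T : finType) (e : rel T) : Prop :=
  symmetric e /\ irreflexive e.

Definition connected_graph (T : finType) (e : rel T) : Prop :=
  forall x y : T, connect e x y.

Definition neighborhood (T : finType) (e : rel T) (v : T) : {set T} :=
  [set w | e v w].

(* The default #|T| is never below a degree, so on a nonempty graph this is
   the minimum of the degrees. *)
Definition min_degree (T : finType) (e : rel T) : nat :=
  \big[minn/#|T|]_(v : T) #|neighborhood e v|.

Definition total12_set (T : finType) (e : rel T) (S : {set T}) : bool :=
  [forall v, 1 <= #|neighborhood e v :&: S| <= 2].

(* The minimum over the empty family is +oo. *)
Definition gamma_t12 (T : finType) (e : rel T) : \bar rat :=
  \big[Order.min/+oo%E]_(S : {set T} | total12_set e S) (#|S|%:R)%:E.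

(* Main.v *)
Require Import Defs.
From mathcomp Require Import all_boot all_order all_algebra.
From mathcomp Require Import constructive_ereal.
From mathcomp Require Import zify lra.
Set Implicit Arguments.
Unset Strict Implicit.
Unset Printing Implicit Defensive.
Import Order.TTheory GRing.Theory Num.Theory.

(** Let S be an inclusion-minimal total [1,2]-set.  Every vertex outside S hands
    a weight of 2 to its neighbours in S: all of it to a unique neighbour, or 1
    to each of two.  Minimality gives every v in S a private neighbour, that is
    a vertex whose only neighbour in S is v.  If v in S receives nothing, then
    all its neighbours lie in S, so its private neighbour u lies in S and, as v
    has another neighbour in S, the private neighbour of u lies outside S and u
    receives at least 2.  Since v is recovered from u, the deficits are
    compensated and |S| <= 2 (n - |S|). *)

Section MinimalTotal12Set.

Variables (T : finType) (e : rel T).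
Hypotheses (esym : symmetric e)
  (deg2 : forall v, 2 <= #|neighborhood e v|).
Variable S : {set T}.
Hypotheses (totS : total12_set e S)
  (minS : forall v, v \in S -> ~~ total12_set e (S :\ v)).

Local Notation NS x := (neighborhood e x :&: S).

Lemma total12_bounds x : 1 <= #|NS x| <= 2.
Proof. exact: (forallP totS x). Qed.

(** Deleting [v] cannot break the upper bound 2, so some [u] loses its last neighbour in [S], which
    is [v]. *)
Lemma private_neighbor v : v \in S -> exists u, NS u = [set v].
Proof.
move=> vS; have /forallPn [u] := minS vS; have /andP [lo hi] := total12_bounds u.
rewrite setIDA.
case: (boolP (v \in NS u)) => [vNu|vNu].
- move: (cardsD1 v (NS u)); rewrite vNu => eqc Hu; exists u.
  have c1 : #|NS u| == 1 by lia.
  by case/cards1P: c1 vNu => w ->; rewrite inE => /eqP ->.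
- have -> : NS u :\ v = NS u by apply/setDidPl; rewrite disjoint_sym disjoints1.
  by rewrite lo hi.
Qed.

(** The division is exact, since [#|NS x|] is 1 or 2. *)
Definition share (x : T) : nat := 2 %/ #|NS x|.

Definition received (v : T) : nat := \sum_(x in ~: S | e x v) share x.

Lemma share_gt0 x : 0 < share x.
Proof. by rewrite divn_gt0; case/andP: (total12_bounds x). Qed.

Lemma sum_received : \sum_(v in S) received v = 2 * #|~: S|.
Proof.
rewrite /received (exchange_big_dep (fun x => x \in ~: S)) /=; last by move=> v x _ /andP[].
rewrite mulnC -sum_nat_const; apply: eq_bigr => x xS.
rewrite (eq_bigl [in NS x]); last by move=> v; rewrite !inE -in_setC xS andbC.
rewrite sum_nat_const /share.
by case: #|NS x| (total12_bounds x) => [|[|[|]]].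
Qed.

Lemma received0_neighbor v w : received v = 0 -> e v w -> w \in S.
Proof.
move=> r0 evw; apply/negPn/negP => wS; move: r0; rewrite /received (bigD1 w) /=.
  by have := share_gt0 w; lia.
by rewrite inE wS esym.
Qed.

Lemma received_private u w : w \notin S -> NS w = [set u] -> 2 <= received u.
Proof.
move=> wS Nw; have /setIP [] : u \in NS w by rewrite Nw set11.
rewrite inE => ewu _; rewrite /received (bigD1 w) /=; last by rewrite inE wS.
by rewrite /share Nw cards1; lia.
Qed.

Lemma received0_compensated v : v \in S -> received v = 0 ->
  exists u, [/\ u \in S, 2 <= received u & NS u = [set v]].
Proof.
move=> vS r0; have [u Nu] := private_neighbor vS.
have /setIP [] : v \in NS u by rewrite Nu set11.
rewrite inE esym => evu _; have uS := received0_neighbor r0 evu.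
exists u; split=> //; have [w Nw] := private_neighbor uS.
(* If [w] were in [S], it would be [v], the only neighbour of [u] in [S]; as all neighbours of [v]
   lie in [S], [v] would then have degree 1. *)
apply: (received_private _ Nw); apply/negP => wS.
have wv : w = v.
  apply/set1P; rewrite -Nu !inE wS andbT esym.
  have /setIP [] : u \in NS w by rewrite Nw set11.
  by rewrite inE.
have /setIidPl Nv : neighborhood e v \subset S.
  by apply/subsetP => x; rewrite inE; apply: received0_neighbor.
by have := deg2 v; rewrite -Nv -wv Nw cards1.
Qed.

Lemma card_minimal_total12 : #|S| <= 2 * #|~: S|.
Proof.
pose Z := [set v in S | received v == 0].
pose W := [set u in S | 2 <= received u].
have leZW : #|Z| <= #|W|.
  (* [h] recovers [v] from its private neighbour [u], so [Z] lies in the image of [W]; the default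
     [u] is never reached there. *)
  pose h u := odflt u [pick v in NS u].
  apply: leq_trans (leq_imset_card h [in W]); apply/subset_leq_card/subsetP => v.
  rewrite inE => /andP [vS /eqP /(received0_compensated vS) [u [uS r2 Nu]]].
  apply/imsetP; exists u; first by rewrite !inE uS.
  rewrite /h Nu; case: pickP => [x /set1P //|/(_ v)].
  by rewrite set11.
(* This holds term by term over [S]: with [r = received v], [1 + [r >= 2] <= r + [r = 0]]. *)
suff : #|S| + #|W| <= 2 * #|~: S| + #|Z| by lia.
rewrite -sum_received -(sum1_card [in S]) /Z /W -!sum1dep_card.
rewrite [X in _ + X <= _]big_mkcondr [X in _ <= _ + X]big_mkcondr -!big_split /=.
by apply: leq_sum => v _; case: (received v) => [|[|]].
Qed.

End MinimalTotal12Set.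

Lemma min_degree_le (T : finType) (e : rel T) v :
  min_degree e <= #|neighborhood e v|.
Proof.
rewrite /min_degree; elim: (index_enum T) (mem_index_enum v) => //= a s IH.
rewrite inE big_cons => /orP [/eqP <-|/IH le_s]; first exact: geq_minl.
by apply: leq_trans le_s; apply: geq_minr.
Qed.

Theorem theorem2p5 (T : finType) (e : rel T)
    (hG : simple_graph e) (hconn : connected_graph e)
    (hn : (3 <= #|T|)%N) (hdelta : (2 <= min_degree e)%N) :
  (gamma_t12 e < +oo)%E ->
  (gamma_t12 e <= ((2 * #|T|%:R / 3)%R)%:E)%E.
Proof.
move=> fin.
have [S0 tot0] : exists S, total12_set e S.
  apply/existsP; apply: contraTT fin => /existsPn none.
  rewrite /gamma_t12 big_pred0 ?ltxx // => S; exact/negbTE.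
(* A set of least cardinality is in particular inclusion-minimal. *)
case: (arg_minnP (fun S : {set T} => #|S|) tot0) => S totS minS.
have leS : #|S| <= 2 * #|~: S|.
  apply: (@card_minimal_total12 _ e) => //.
  - by case: hG.
  - by move=> v; apply: leq_trans hdelta (min_degree_le _ _).
  - move=> v vS; apply/negP => /minS.
    by rewrite (cardsD1 v S) vS ltnn.
apply: (@Order.TotalTheory.bigmin_inf _ _ _ _ S) => //.
rewrite lee_fin.
have : (#|S| * 3 <= 2 * #|T|)%N by have := cardsC S; lia.
rewrite -(ler_nat rat) !natrM; lra.
Qed.
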